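(* For any positive integers $j\le r$ and all $0<z<1$, \[ {\rm Li}_{\{1\}_{j-1},2,\{1\}_{r-j}}(1-z)=\sum_{i=0}^{r-j}(-1)^i\binom{i+j}{i}\zeta(i+j+1)\,{\rm Li}_{\{1\}_{r-j-i}}(1-z)+(-1)^{r-j-1}\sum_{l=r-j}^{r}\binom{l}{r-j}{\rm Li}_{\{1\}_{r-l}}(1-z)\,{\rm Li}_{l+1}(z). \]
   Context: Multiple polylogarithm: ${\rm Li}_{k_1,\ldots,k_r}(z)=\sum_{1\le n_1<\cdots<n_r}\frac{z^{n_r}}{n_1^{k_1}\cdots n_r^{k_r}}$ for $z\in[-1,1)$, with ${\rm Li}_{\emptyset}(z)=1$; $\{1\}_j$ denotes $j$ repetitions of $1$; $\zeta$ is the Riemann zeta function. *)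

(* Defs.v *)
From mathcomp Require Import all_boot all_order all_algebra.
From mathcomp Require Import all_classical all_reals all_analysis.

Set Implicit Arguments.
Unset Strict Implicit.
Unset Printing Implicit Defensive.

Import Order.TTheory GRing.Theory Num.Theory.
Import numFieldNormedType.Exports.

Local Open Scope ring_scope.

(* The sum of z^(n_r) / (n_1^(k_1) ... n_r^(k_r)) over all integers
   1 <= n_1 < ... < n_r <= N, where ks = [:: k_1; ...; k_r].
   [path ltn 0 t] says 0 < n_1 < ... < n_r for t = [:: n_1; ...; n_r], and
   [last 0 t] is n_r; for r = 0 the only index is the empty tuple, with n_0 = 0,
   so the sum is z^0 = 1. *)
Definition Li_partial (R : realType) (ks : seq nat) (z : R) (N : nat) : R :=
  \sum_(n : (size ks).-tuple 'I_N.+1 | path ltn 0 (map val n))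
     z ^+ last 0%N (map val n) /
     \prod_(i < size ks) (tnth n i)%:R ^+ nth 0%N ks i.

(* The multiple series is summed by increasing values of its outermost (largest)
   index n_r, which is the meaning of the series where it converges only
   conditionally (z = -1). *)
Definition Li (R : realType) (ks : seq nat) (z : R) : R :=
  limn (Li_partial ks z).

Definition zeta (R : realType) (s : R) : R :=
  limn (fun N : nat => \sum_(1 <= n < N.+1) (n%:R : R) `^ (- s)).

Lemma Li_nil (R : realType) (z : R) : Li [::] z = 1.
Proof.
rewrite /Li (_ : Li_partial [::] z = fun=> 1) ?lim_cst//.
apply/funext => N; rewrite /Li_partial /=.
rewrite (big_pred1 [tuple]) => [|t]; last by rewrite (tuple0 t) /= eqxx.
by rewrite /= big_ord0 expr0 divr1.
Qed.

Lemma Li_seq1 (R : realType) (k : nat) (z : R) :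
  Li [:: k] z = limn (fun N : nat => \sum_(1 <= n < N.+1) z ^+ n / n%:R ^+ k).
Proof.
congr (limn _); apply/funext => N; rewrite /Li_partial /=.
rewrite (reindex (fun i : 'I_N.+1 => [tuple i])) /=; last first.
  exists (fun t : 1.-tuple 'I_N.+1 => thead t) => [i _|t _] //.
  by apply: val_inj => /=; case: t => -[|x []].
rewrite big_mkcond big_ord_recl /= add0r big_add1 big_mkord.
by apply: eq_bigr => i _; rewrite big_ord1 (tnth_nth ord0) /=.
Qed.

(* Main.v *)
Require Import Defs.
From mathcomp Require Import all_boot all_order all_algebra.
From mathcomp Require Import all_classical all_reals all_analysis.
From mathcomp Require Import ring lra zify.

(* Put x = 1 - z, A_k(x) = Li_{1^k}(x) and p_l(x) = Li_l(1 - x).  Then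
   A_(k+1)' = A_k / (1 - x) and p_(l+1)' = - p_l / (1 - x), where
   p_0(x) = Li_0(1 - x) = (1 - x) / x.  Writing d = r - j, let G_d(x) be the
   difference of the two sides.  A telescoping based on Pascal's rule gives
   G_(d+1)' = G_d / (1 - x) and G_0' = 0, so by induction on d every G_d is
   constant on (0, 1).  It tends to 0 as x -> 0+: the only surviving terms
   are the two multiples of zeta(d + j + 1), which cancel. *)

Set Implicit Arguments.
Unset Strict Implicit.
Unset Printing Implicit Defensive.

Import Order.TTheory GRing.Theory Num.Theory.
Import numFieldNormedType.Exports.

Local Open Scope classical_set_scope.
Local Open Scope ring_scope.

(** * Recursion on the outermost index *)

(** The largest entry is split off. It is positive, hence of the form [n.+1], and the remaining
    entries are at most [n], so they live in the smaller type ['I_n.+1]. *)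
Lemma sum_increasing_tuple (R : realType) (r N : nat) (F : seq nat -> R) :
  \sum_(t : r.+1.-tuple 'I_N.+1 | path ltn 0%N (map val t)) F (map val t) =
  \sum_(n < N) \sum_(t : r.-tuple 'I_n.+1 | path ltn 0%N (map val t))
     F (rcons (map val t) n.+1).
Proof.
pose h (p : 'I_N.+1 * r.-tuple 'I_N.+1) := [tuple of rcons p.2 p.1].
pose g (t : r.+1.-tuple 'I_N.+1) :=
  (last ord0 t, [tuple of belast (thead t) (behead t)]).
rewrite (reindex h) /=; last first.
  exists g => [[x t] _ | t _].
    rewrite /g /h /=; congr pair; first by rewrite last_rcons.
    apply: val_inj => /=; case: t => -[|y s] Hs //=.
    by rewrite /thead (tnth_nth ord0) /= belast_rcons.
  apply: val_inj => /=; case: t => -[|y s] Hs //=.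
  by rewrite /thead (tnth_nth ord0) /= -lastI.
under eq_bigl => p do rewrite map_rcons rcons_path.
under eq_bigr => p do rewrite map_rcons.
rewrite -(pair_big_dep xpredT
  (fun (x : 'I_N.+1) (t : r.-tuple 'I_N.+1) =>
     path ltn 0%N (map val t) && (last 0%N (map val t) < x)%N)
  (fun x t => F (rcons (map val t) (val x)))) /=.
(* Nothing lies below a largest entry equal to 0, so that term is empty. *)
rewrite big_ord_recl /= [X in X + _]big1 ?add0r => [|t /andP[_]]; last by [].
apply: eq_bigr => n _; rewrite /bump /= add1n.
have nN : (n.+1 <= N.+1)%N by rewrite ltnS ltnW.
(* [inord] inverts the widening on tuples with all entries at most [n]. In an increasing tuple it is
   enough that the last entry is. *)
rewrite (reindex_onto (fun t : r.-tuple 'I_n.+1 => map_tuple (widen_ord nN) t)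
  (fun t : r.-tuple 'I_N.+1 => map_tuple (fun i : 'I_N.+1 => inord i) t)) /=;
  last first.
  move=> t /andP[pt lt]; apply: val_inj => /=; rewrite -map_comp.
  rewrite -[RHS]map_id; apply/eq_in_map => i it; apply: val_inj => /=.
  rewrite inordK//.
  have : sorted leq (map val t).
    by move: pt => /path_sorted; apply: sub_sorted => a b /ltnW.
  have it' : val i \in map val t by apply: map_f.
  move=> st; apply: leq_ltn_trans lt.
  move: it' st; case/lastP: (map val t) => [//|s y].
  rewrite last_rcons mem_rcons inE => /orP[/eqP->//|it'] /=.
  rewrite (sorted_pairwise leq_trans) pairwise_rcons => /andP[/allP + _].
  exact.
apply: congr_big => // [t|t _].
  rewrite -map_comp (_ : map (val \o widen_ord nN) t = map val t)//.
  have -> : (map_tuple (fun i : 'I_N.+1 => inord i) (map_tuple (widen_ord nN) t)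
       == t) = true.
    apply/eqP/val_inj => /=; rewrite -map_comp -[RHS]map_id.
    by apply/eq_map => i /=; apply: val_inj; rewrite /= inordK.
  rewrite andbT; case: (path _ _ _) => //=.
  case/lastP: (tval t) => [//|s y]; rewrite map_rcons last_rcons.
  exact: ltn_ord.
by rewrite -map_comp.
Qed.

(* Taylor coefficients at 0 of Li_{ks,k}. *)
Definition Li_coef (R : realType) (ks : seq nat) (k n : nat) : R :=
  if n is m.+1 then Li_partial ks 1 m / m.+1%:R ^+ k else 0.

(** The summand becomes a function of a plain sequence, as [sum_increasing_tuple] requires. The
    separate length [r] lets [size (rcons ks k)] be replaced by a successor without casting
    tuples. *)
Lemma Li_partialE (R : realType) (ks : seq nat) (z : R) (N r : nat)
    (F : seq nat -> R) :
  r = size ks ->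
  (forall s, F s =
    z ^+ last 0%N s / \prod_(i < r) (nth 0%N s i)%:R ^+ nth 0%N ks i) ->
  Li_partial ks z N =
    \sum_(t : r.-tuple 'I_N.+1 | path ltn 0%N (map val t)) F (map val t).
Proof.
move=> -> FE; apply: eq_bigr => t _; rewrite FE; congr (_ / _).
by apply: eq_bigr => i _; rewrite (tnth_nth ord0) (nth_map ord0) ?size_tuple.
Qed.

Lemma Li_partial_rcons (R : realType) (ks : seq nat) (k : nat) (z : R) (N : nat) :
  Li_partial (rcons ks k) z N = pseries (Li_coef R ks k) z N.+1.
Proof.
pose F s : R := z ^+ last 0%N s /
  \prod_(i < (size ks).+1) (nth 0%N s i)%:R ^+ nth 0%N (rcons ks k) i.
rewrite (@Li_partialE R _ z N _ F (esym (size_rcons ks k)))// sum_increasing_tuple.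
rewrite /pseries /series /= big_nat_recl//= mul0r add0r big_mkord.
apply: eq_bigr => n _.
rewrite (@Li_partialE R ks 1 n _ _ erefl (fun=> erefl)) !mulr_suml.
apply: eq_bigr => t _; rewrite /F last_rcons expr1n big_ord_recr/=.
rewrite !nth_rcons size_map size_tuple !ltnn !eqxx mul1r.
rewrite invfM mulrC; congr (_^-1 * _ * _).
by apply: eq_bigr => i _; rewrite !nth_rcons size_map size_tuple ltn_ord.
Qed.

(** * Multiple polylogarithms as power series *)

Lemma pseriesS (R : realType) (c : R^nat) (x : R) (n : nat) :
  pseries c x n.+1 = pseries c x n + c n * x ^+ n.
Proof. exact: seriesSr. Qed.

(** Each of the [n.+1] terms of (K^(n+1) - y^(n+1)) / (K - y) is at least y^n. The bound absorbs the
    factor [n.+1] created by differentiation into a slightly larger radius. *)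
Lemma natr_mul_expr_le (R : realType) (n : nat) (y K : R) :
  0 <= y -> y <= K -> n.+1%:R * y ^+ n * (K - y) <= K ^+ n.+1.
Proof.
move=> y0 yK; elim: n => [|n IH]; first by rewrite expr0 expr1 !mul1r; lra.
have := ler_wpM2l y0 IH.
have : y ^+ n.+1 * (K - y) <= K ^+ n.+1 * (K - y).
  by apply: ler_wpM2r; [rewrite subr_ge0|apply: lerXn2r; rewrite ?nnegrE//; lra].
rewrite -[n.+2%:R]natr1 !(exprS _ n.+1) (exprS y n); nra.
Qed.

(** Comparison with the absolutely convergent series at an intermediate radius [K'], divided by the
    constant [K' - |y|]. *)
Lemma is_cvg_pseries_diffs (R : realType) (c : R^nat) (K y : R) :
  cvgn (pseries c K) -> `|y| < `|K| -> cvgn (pseries (pseries_diffs c) y).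
Proof.
move=> cK yK; have y0 := normr_ge0 y; pose K' : R := (`|y| + `|K|) / 2.
have yK' : `|y| < K' by rewrite /K'; lra.
have K'0 : 0 <= K' by lra.
have K'K : `|K'| < `|K| by rewrite (ger0_norm K'0) /K'; lra.
pose v n := `|c n| * K' ^+ n / (K' - `|y|).
have v0 n : 0 <= v n.
  by rewrite /v !mulr_ge0 ?exprn_ge0// invr_ge0 subr_ge0 ltW.
apply: normed_cvg; apply: (@series_le_cvg _ _ (fun n => v n.+1)) => [n|n|n|];
  rewrite ?normr_ge0 ?v0//.
  rewrite /= /pseries_diffs !normrM normrX ger0_norm// mulrAC /v mulrC -!mulrA.
  rewrite ler_wpM2l// ler_pdivlMr ?subr_gt0//.
  exact: natr_mul_expr_le (ltW yK').
have cv : cvgn (series v).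
  have -> : v = (K' - `|y|)^-1 *: (fun n => `|c n| * K' ^+ n).
    by apply/funext => n; rewrite /v mulrC.
  exact/is_cvg_seriesZ/(is_cvg_pseries_inside_norm cK K'K).
(* The differentiated series is compared with [v] shifted by one, so the term of index 0 is
   discarded. *)
have := cv; rewrite -(is_cvg_series_restrict 1) => /cvg_ex[l].
rewrite -cvg_shiftS => vl; apply/cvg_ex; exists l.
apply: cvg_trans vl; apply: near_eq_cvg; apply: nearW => n.
by rewrite /series /= big_add1.
Qed.

Lemma is_derive_pseries (R : realType) (c : R^nat) (K x : R) :
  cvgn (pseries c K) -> `|x| < `|K| ->
  is_derive x (1 : R) (fun x => limn (pseries c x))
    (limn (pseries (pseries_diffs c) x)).
Proof.
move=> cK xK.
(* Each termwise differentiation costs some radius. Two intermediate radii make the series and its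
   first two derived series all converge at [K2], beyond [|x|]. *)
pose K1 : R := (`|x| + `|K|) / 2; pose K2 : R := (`|x| + K1) / 2.
have [xK2 K21 K1K] : [/\ `|x| < `|K2|, `|K2| < `|K1| & `|K1| < `|K|].
  have x0 := normr_ge0 x.
  have k1 : `|K1| = K1 by apply: ger0_norm; rewrite /K1; lra.
  have k2 : `|K2| = K2 by apply: ger0_norm; rewrite /K2 /K1; lra.
  by rewrite k1 k2 /K2 /K1; split; lra.
have cd := is_cvg_pseries_diffs cK K1K.
apply: (@pseries_snd_diffs _ _ K2) => //.
- exact: is_cvg_pseries_inside cK (lt_trans K21 K1K).
- exact: is_cvg_pseries_inside cd K21.
- exact: is_cvg_pseries_diffs cd K21.
Qed.

(** Convergence is not assumed: both sides choose a point from the same set of limits. *)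
Lemma limn_shiftS (R : realType) (u : R^nat) : limn (fun n => u n.+1) = limn u.
Proof.
by rewrite /lim_in; congr (get _); apply/funext => l; exact: (cvg_shiftS u).
Qed.

Lemma Li_rcons (R : realType) (ks : seq nat) (k : nat) (z : R) :
  Li (rcons ks k) z = limn (pseries (Li_coef R ks k) z).
Proof.
rewrite -limn_shiftS; congr (limn _); apply/funext => N.
exact: Li_partial_rcons.
Qed.

(** * Monotonicity, Abel summation and convergence on [0, 1) *)

Lemma Li_partial_nil (R : realType) (z : R) (N : nat) : Li_partial [::] z N = 1.
Proof.
rewrite /Li_partial /= (big_pred1 [tuple]) => [|t]; last first.
  by rewrite (tuple0 t) /= eqxx.
by rewrite /= big_ord0 expr0 divr1.
Qed.

Lemma Li_partial_ge0 (R : realType) (ks : seq nat) (z : R) (N : nat) :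
  0 <= z -> 0 <= Li_partial ks z N.
Proof.
move=> z0; apply: sumr_ge0 => t _; apply: mulr_ge0; first exact: exprn_ge0.
by rewrite invr_ge0; apply: prodr_ge0 => i _; apply: exprn_ge0.
Qed.

Lemma Li_coef_ge0 (R : realType) (ks : seq nat) (k n : nat) :
  0 <= Li_coef R ks k n.
Proof.
case: n => [//|n]; apply: mulr_ge0; first exact: Li_partial_ge0.
by rewrite invr_ge0 exprn_ge0.
Qed.

(** The increment at 1 is the coefficient of z^(N+1). Writing it as a difference of partial sums
    covers the empty index too. *)
Lemma Li_partialS (R : realType) (ks : seq nat) (z : R) (N : nat) :
  Li_partial ks z N.+1 =
  Li_partial ks z N + z ^+ N.+1 * (Li_partial ks 1 N.+1 - Li_partial ks 1 N).
Proof.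
case/lastP: ks => [|ks k]; first by rewrite !Li_partial_nil subrr mulr0 addr0.
rewrite !Li_partial_rcons !pseriesS !expr1n; ring.
Qed.

Lemma Li_partial0 (R : realType) (ks : seq nat) (z : R) :
  Li_partial ks z 0 = Li_partial ks 1 0.
Proof.
case/lastP: ks => [|ks k]; first by rewrite !Li_partial_nil.
by rewrite !Li_partial_rcons /pseries /series /= !big_nat1 !mul0r.
Qed.

(** Abel summation: multiplying the generating series of the partial sums by 1 - x recovers the
    series itself, up to a boundary term. *)
Lemma pseries_Li_partial (R : realType) (ks : seq nat) (x : R) (N : nat) :
  (1 - x) * pseries (Li_partial ks 1) x N.+1 =
  Li_partial ks x N - x ^+ N.+1 * Li_partial ks 1 N.
Proof.
elim: N => [|N IH].
  by rewrite /pseries /series/= big_nat1 expr0 expr1 (Li_partial0 _ x); ring.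
by rewrite pseriesS mulrDr IH (Li_partialS ks x) (exprS _ N.+1); ring.
Qed.

Lemma nondecreasing_Li_partial (R : realType) (ks : seq nat) (z : R) :
  0 <= z -> nondecreasing_seq (Li_partial ks z).
Proof.
move=> z0; apply/nondecreasing_seqP => n.
case/lastP: ks => [|ks k]; first by rewrite !Li_partial_nil.
rewrite !Li_partial_rcons (pseriesS _ _ n.+1) lerDl.
by rewrite mulr_ge0 ?exprn_ge0 ?Li_coef_ge0.
Qed.

Lemma Li_coef_le (R : realType) (ks : seq nat) (k n : nat) :
  Li_coef R ks k n <= Li_partial ks 1 n.
Proof.
case: n => [|n]; first exact: Li_partial_ge0.
apply: (@le_trans _ _ (Li_partial ks 1 n)); last first.
  by apply: nondecreasing_Li_partial.
by rewrite ler_pdivrMr ?exprn_gt0// ler_peMr ?Li_partial_ge0// exprn_ege1// ler1n.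
Qed.

(* All terms are nonnegative, so it suffices to bound the partial sums of Li ks;
   this is done by induction on ks, each new index costing a factor
   1 / (1 - x). *)
Lemma is_cvg_pseries_Li_partial (R : realType) (ks : seq nat) (x : R) :
  0 <= x -> x < 1 -> cvgn (pseries (Li_partial ks 1) x).
Proof.
move=> x0 x1; have x10 : 0 < 1 - x by lra.
have nd ls : nondecreasing_seq (pseries (Li_partial ls (1 : R)) x).
  apply/nondecreasing_seqP => n; rewrite pseriesS lerDl.
  by rewrite mulr_ge0 ?exprn_ge0 ?Li_partial_ge0.
suff [M HM] : exists M, forall n, Li_partial ks x n <= M.
  apply: nondecreasing_is_cvgn; first exact: nd.
  exists (M / (1 - x)) => _ [n _ <-]; apply: le_trans (nd _ _ _ (leqnSn n)) _.
  rewrite ler_pdivlMr// mulrC pseries_Li_partial; apply: le_trans (HM n).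
  by rewrite gerBl mulr_ge0 ?exprn_ge0 ?Li_partial_ge0.
elim/last_ind: ks => [|ks k [M HM]].
  by exists 1 => n; rewrite Li_partial_nil.
exists (M / (1 - x)) => n; rewrite Li_partial_rcons.
apply: (@le_trans _ _ (pseries (Li_partial ks (1 : R)) x n.+1)); last first.
  rewrite ler_pdivlMr// mulrC pseries_Li_partial; apply: le_trans (HM n).
  by rewrite gerBl mulr_ge0 ?exprn_ge0 ?Li_partial_ge0.
by apply: ler_sum => i _; rewrite ler_wpM2r ?exprn_ge0 ?Li_coef_le.
Qed.

Lemma is_cvg_pseries_Li_coef (R : realType) (ks : seq nat) (k : nat) (x : R) :
  0 <= x -> x < 1 -> cvgn (pseries (Li_coef R ks k) x).
Proof.
move=> x0 x1; have := is_cvg_pseries_Li_partial (ks := ks) x0 x1.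
apply: series_le_cvg => n.
- by rewrite mulr_ge0 ?exprn_ge0 ?Li_coef_ge0.
- by rewrite mulr_ge0 ?exprn_ge0 ?Li_partial_ge0.
- by rewrite ler_wpM2r ?exprn_ge0 ?Li_coef_le.
Qed.

(** * Differentiation and lowering of the outermost exponent *)

Lemma is_derive_Li (R : realType) (ks : seq nat) (k : nat) (x : R) :
  `|x| < 1 ->
  is_derive x 1 (@Li R (rcons ks k))
    (limn (pseries (pseries_diffs (Li_coef R ks k)) x)).
Proof.
move=> x1; have x0 := normr_ge0 x.
have -> : @Li R (rcons ks k) = fun x => limn (pseries (Li_coef R ks k) x).
  by apply/funext => y; rewrite Li_rcons.
have h : cvgn (pseries (Li_coef R ks k) ((1 + `|x|) / 2)).
  by apply: is_cvg_pseries_Li_coef; lra.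
by apply: (is_derive_pseries h); rewrite (@ger0_norm _ ((1 + `|x|) / 2)); lra.
Qed.

(** The operator x d/dx multiplies the coefficient of x^n by n, which cancels one power of n in the
    denominator. *)
Lemma mul_lim_pseries_diffs_Li_coef (R : realType) (ks : seq nat) (k : nat)
    (x : R) :
  0 <= x -> x < 1 ->
  x * limn (pseries (pseries_diffs (Li_coef R ks k.+1)) x) = Li (rcons ks k) x.
Proof.
move=> x0 x1.
have c1 : cvgn (pseries (pseries_diffs (Li_coef R ks k.+1)) x).
  have h : cvgn (pseries (Li_coef R ks k.+1) ((1 + x) / 2)).
    by apply: is_cvg_pseries_Li_coef; lra.
  by apply: (is_cvg_pseries_diffs h); rewrite !ger0_norm; lra.
rewrite Li_rcons -(limn_shiftS (pseries (Li_coef R ks k) x)).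
apply/esym/cvg_lim => //.
suff -> : (fun N => pseries (Li_coef R ks k) x N.+1) =
    (fun N => x * pseries (pseries_diffs (Li_coef R ks k.+1)) x N).
  exact: cvgMl_tmp.
apply/funext => N.
rewrite /pseries /series/= big_nat_recl//= mul0r add0r mulr_sumr.
apply: eq_bigr => i _; rewrite /pseries_diffs /= !exprS invfM.
have : i.+1%:R != 0 :> R by rewrite pnatr_eq0.
by move=> i0; field; rewrite expf_neq0 ?nat1r.
Qed.

(* An exponent 0 lets the differentiation rule for an outermost exponent 1 be an
   instance of the rule lowering the outermost exponent. *)
Lemma Li_rcons0_exponent (R : realType) (ks : seq nat) (x : R) :
  0 <= x -> x < 1 -> Li (rcons ks 0) x = x / (1 - x) * Li ks x.
Proof.
move=> x0 x1; have x10 : 1 - x != 0 by rewrite subr_eq0 gt_eqF.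
have c1 := is_cvg_pseries_Li_partial (ks := ks) x0 x1.
have -> : Li (rcons ks 0) x = x * limn (pseries (Li_partial ks 1) x).
  rewrite Li_rcons -(limn_shiftS (pseries (Li_coef R ks 0) x)).
  apply/cvg_lim => //.
  suff -> : (fun N => pseries (Li_coef R ks 0) x N.+1) =
      (fun N => x * pseries (Li_partial ks 1) x N).
    exact: cvgMl_tmp.
  apply/funext => N.
  rewrite /pseries /series/= big_nat_recl//= mul0r add0r mulr_sumr.
  by apply: eq_bigr => i _; rewrite expr0 exprS; field.
have -> : Li ks x = (1 - x) * limn (pseries (Li_partial ks 1) x).
  apply/cvg_lim => //.
  (* The boundary term of Abel summation is [x] times the general term of a convergent series. *)
  have c0 : Li_partial ks 1 n * x ^+ n @[n --> \oo] --> (0 : R).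
    exact: cvg_series_cvg_0 c1.
  have c2 : pseries (Li_partial ks 1) x n.+1 @[n --> \oo] -->
      limn (pseries (Li_partial ks 1) x).
    by have := c1; rewrite -(cvg_shiftS (pseries _ x)).
  suff -> : Li_partial ks x = (fun n =>
      (1 - x) * pseries (Li_partial ks 1) x n.+1 +
      x * (Li_partial ks 1 n * x ^+ n)).
    rewrite -(addr0 ((1 - x) * _)) -[X in _ * _ + X](mulr0 x).
    by apply: cvgD; apply: cvgMl_tmp.
  apply/funext => n.
  by rewrite pseries_Li_partial exprS; ring.
by field.
Qed.

(** * Behaviour at the endpoints *)

Lemma Li_rcons_at0 (R : realType) (ks : seq nat) (k : nat) :
  Li (rcons ks k) (0 : R) = 0.
Proof.
rewrite Li_rcons; transitivity (limn (fun=> 0 : R)); last exact: lim_cst.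
congr (limn _).
apply/funext => N; rewrite /pseries /series/= big1// => -[|i] _.
  by rewrite mul0r.
by rewrite expr0n mulr0.
Qed.

(** The quotient is the difference quotient at 0, since the function vanishes there. *)
Lemma Li_rcons_div_cvg0 (R : realType) (ks : seq nat) (k : nat) :
  exists l : R, Li (rcons ks k) x / x @[x --> 0^'+] --> l.
Proof.
have := @is_derive_Li R ks k 0; rewrite normr0 => /(_ ltr01)[D _].
exists (lim (h^-1 *: (Li (rcons ks k) (h *: 1 + 0) - Li (rcons ks k) (0:R))
  @[h --> 0^'])).
have := cvg_dnbhs_at_right D.
suff -> : (fun x : R => Li (rcons ks k) x / x) =
   (fun h => h^-1 *: (Li (rcons ks k) (h *: 1 + 0) - Li (rcons ks k) (0:R))) by [].
apply/funext => x; rewrite Li_rcons_at0 subr0 addr0 mulrC.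
by rewrite /GRing.scale/= mulr1.
Qed.

Lemma Li_rcons_cvg0 (R : realType) (ks : seq nat) (k : nat) :
  Li (rcons ks k) x @[x --> 0^'+] --> (0 : R).
Proof.
have [l] := Li_rcons_div_cvg0 R ks k.
have x0 : (x : R) @[x --> 0^'+] --> (0 : R).
  exact: (@cvg_at_right_filter _ _ id).
move=> /(cvgM x0); rewrite mul0r.
apply: cvg_trans; apply: near_eq_cvg; near=> x => /=.
have x_gt0 : x > 0 by near: x; exact: nbhs_right_gt.
by rewrite /= mulrC divfK ?gt_eqF.
Unshelve. all: by end_near. Qed.

(** The mean value theorem makes [G] constant to the left of [x], and the limit at 0 identifies the
    constant. *)
Lemma eq0_from_derive0 (R : realType) (G : R -> R) :
  (forall x : R, 0 < x -> x < 1 -> is_derive x 1 G 0) ->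
  G x @[x --> 0^'+] --> 0 -> forall x, 0 < x -> x < 1 -> G x = 0.
Proof.
move=> dG G0 x x0 x1.
have cst y : 0 < y -> y < x -> G y = G x.
  move=> y0 yx; apply/esym/eqP; rewrite -subr_eq0.
  have dG' z : z \in `]y, x[%R -> is_derive z 1 G ((fun=> 0 : R) z).
    by rewrite in_itv/= => /andP[? ?]; apply: dG; lra.
  have [|c _ ->] := MVT yx dG'; last by rewrite mul0r.
  apply: derivable_within_continuous => z. rewrite in_itv/= => /andP[? ?].
  by have [] : is_derive z 1 G 0 by apply: dG; lra.
apply/esym/(cvg_unique _ G0) => //.
have : G x @[_ --> (0:R)^'+] --> G x by exact: cvg_cst.
apply: cvg_trans; apply: near_eq_cvg; near=> y; apply: esym (cst _ _ _).
  by near: y; exact: nbhs_right_gt.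
by near: y; exact: nbhs_right_lt.
Unshelve. all: by end_near. Qed.

(** * Polylogarithms of depth one near 1 *)

Lemma bernoulli_le (R : realType) (n : nat) (x : R) :
  0 <= x -> x <= 1 -> 1 - n%:R * x <= (1 - x) ^+ n.
Proof.
move=> x0 x1; elim: n => [|n IH]; first by rewrite mul0r subr0.
have : 0 <= n%:R :> R by [].
have x10 : 0 <= 1 - x by lra.
by rewrite exprS -natr1 => n0; have := ler_wpM2l x10 IH; nra.
Qed.

Lemma Li_coef_nilE (R : realType) (k n : nat) :
  Li_coef R [::] k n.+1 = (n.+1%:R ^+ k)^-1.
Proof. by rewrite /= Li_partial_nil mul1r. Qed.

Lemma Li_coef_nil_le1 (R : realType) (k n : nat) : Li_coef R [::] k n <= 1.
Proof. by apply: le_trans (Li_coef_le _ _ _ _) _; rewrite Li_partial_nil. Qed.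

(* Split at n = N: 1/n <= 1 below and 1/n <= 1/(N+1) above. *)
Lemma polylog_bound (R : realType) (k N : nat) (y : R) :
  0 <= y -> y < 1 -> (1 - y) * Li [:: k.+1] y <= (1 - y) * N.+1%:R + N.+1%:R^-1.
Proof.
move=> y0 y1; have y10 : 0 < 1 - y by rewrite subr_gt0.
have N0 : 0 < N.+1%:R :> R by [].
(* Among the first [M] terms, [minn M N.+1] have index at most [N] and are bounded by 1. The others
   are bounded by a full geometric sum, whose product with 1 - y is 1 - y^M. *)
have H M : (1 - y) * pseries (Li_coef R [::] k.+1) y M <=
    (1 - y) * (minn M N.+1)%:R + (1 - y ^+ M) / N.+1%:R.
  elim: M => [|M IH].
    by rewrite /pseries /series/= big_geq// min0n expr0 subrr mul0r !mulr0 addr0.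
  have yM0 : 0 <= y ^+ M by exact: exprn_ge0.
  have yM1 : y ^+ M <= 1 by rewrite exprn_ile1// ltW.
  have c0 := Li_coef_ge0 R [::] k.+1 M.
  have c1 := Li_coef_nil_le1 R k.+1 M.
  rewrite pseriesS mulrDr exprS /=.
  have [MN|NM] := leqP M N.
    have -> : minn M.+1 N.+1 = (minn M N.+1).+1 by lia.
    rewrite -[(minn M N.+1).+1%:R]natr1.
    have : 0 <= (y ^+ M - y * y ^+ M) / N.+1%:R.
      by rewrite divr_ge0// subr_ge0 ler_piMl// ltW.
    have : Li_coef R [::] k.+1 M * y ^+ M <= 1 by nra.
    move=> /(ler_wpM2l (ltW y10)) h1 h2.
    by move: IH h1 h2; move: (_^-1) (_%:R) (pseries _ _ _) => a b c *; lra.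
  have -> : minn M.+1 N.+1 = minn M N.+1 by lia.
  have : Li_coef R [::] k.+1 M <= N.+1%:R^-1.
    case: M NM {IH yM0 yM1 c0 c1} => [//|M NM]; rewrite Li_coef_nilE.
    rewrite lef_pV2 ?posrE ?exprn_gt0// exprS.
    apply: le_trans (_ : M.+1%:R <= _); first by rewrite ler_nat.
    by rewrite ler_peMr// exprn_ege1// ler1n.
  move=> cN; have := ler_wpM2l (ltW y10) (ler_wpM2r yM0 cN); move: IH.
  by move: (_^-1) (_%:R) (pseries _ _ _) => a b c *; lra.
have c : cvgn (pseries (Li_coef R [::] k.+1) y) by exact: is_cvg_pseries_Li_coef.
rewrite (Li_rcons [::]) mulrC -ler_pdivlMr//; apply: limr_le => //.
apply: nearW => M; rewrite ler_pdivlMr// mulrC; apply: le_trans (H M) _.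
apply: lerD; first by rewrite ler_pM2l// ler_nat geq_minr.
by rewrite ler_pdivrMr// mulVf ?gt_eqF// gerBl exprn_ge0.
Qed.

Lemma Li_ge0 (R : realType) (ks : seq nat) (k : nat) (y : R) :
  0 <= y -> y < 1 -> 0 <= Li (rcons ks k) y.
Proof.
move=> y0 y1; rewrite Li_rcons; apply: limr_ge.
  exact: is_cvg_pseries_Li_coef.
apply: nearW => M; apply: sumr_ge0 => i _.
by rewrite mulr_ge0 ?exprn_ge0 ?Li_coef_ge0.
Qed.

(** The case that matters is k = 0, where Li_1(1 - x) = - log x diverges. In [polylog_bound], [N] is
    fixed first to make 1/(N+1) small, and then [x] is taken small against N+1. *)
Lemma mul_polylog_cvg (R : realType) (k : nat) :
  x * Li [:: k.+1] (1 - x) @[x --> 0^'+] --> (0 : R).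
Proof.
apply/cvgrPdist_lt => e e0.
pose N := Num.trunc (2 / e).
have Ne : N.+1%:R^-1 < e / 2.
  rewrite -[e / 2]invrK ltf_pV2 ?posrE ?invr_gt0 ?divr_gt0// invf_div.
  exact: truncnS_gt.
near=> x.
have x0 : 0 < x by near: x; exact: nbhs_right_gt.
have x1 : x < 1 by near: x; apply: nbhs_right_lt.
have xN : x < e / 2 / N.+1%:R.
  by near: x; apply: nbhs_right_lt; rewrite !divr_gt0.
rewrite ltr_pdivlMr// in xN.
have l0 : 0 <= Li [:: k.+1] (1 - x) by apply: (@Li_ge0 R [::]); lra.
have l1 : x * Li [:: k.+1] (1 - x) <= x * N.+1%:R + N.+1%:R^-1.
  by have := @polylog_bound R k N (1 - x); rewrite subKr; apply; lra.
rewrite sub0r normrN ger0_norm ?mulr_ge0 ?(ltW x0)//.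
by apply: le_lt_trans l1 _; rewrite [ltRHS]splitr ltrD.
Unshelve. all: by end_near. Qed.

Lemma is_cvg_pseries_Li_coef_nil_1 (R : realType) (k : nat) :
  cvgn (pseries (Li_coef R [::] k.+2) 1).
Proof.
apply: nondecreasing_is_cvgn.
  apply/nondecreasing_seqP => n; rewrite pseriesS lerDl.
  by rewrite mulr_ge0 ?exprn_ge0 ?Li_coef_ge0.
(* Comparison with the telescoping sum of 1/(m(m+1)). The last index among [n.+2] terms is [n.+1],
   because the count starts at 0. *)
have H n : pseries (Li_coef R [::] k.+2) 1 n.+2 <= 2 - n.+1%:R^-1.
  elim: n => [|n IH].
    rewrite /pseries /series/= !big_nat_recr//= big_geq// Li_partial_nil.
    by rewrite !expr1n invr1; lra.
  rewrite pseriesS Li_coef_nilE expr1n mulr1.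
  have n1 : 0 < n.+1%:R :> R by [].
  have n2 : 0 < n.+2%:R :> R by [].
  have : (n.+2%:R ^+ k.+2)^-1 <= n.+1%:R^-1 - n.+2%:R^-1 :> R.
    have -> : n.+1%:R^-1 - n.+2%:R^-1 = (n.+1%:R * n.+2%:R)^-1 :> R.
      by rewrite -[n.+2%:R]natr1 in n2 *; field; rewrite !gt_eqF.
    have p1 : n.+1%:R * n.+2%:R \is @Num.pos R by rewrite posrE mulr_gt0.
    have p2 : n.+2%:R ^+ k.+2 \is @Num.pos R by rewrite posrE exprn_gt0.
    rewrite (lef_pV2 p2 p1) !exprS mulrA.
    apply: (@le_trans _ _ (n.+2%:R * n.+2%:R)).
      by rewrite ler_pM2r// ler_nat.
    by rewrite ler_peMr ?mulr_ge0// exprn_ege1// ler1n.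
  by move=> /(lerD IH); rewrite addrA subrK.
exists 2 => _ [n _ <-].
apply: (@le_trans _ _ (pseries (Li_coef R [::] k.+2) 1 n.+2)).
  rewrite !pseriesS -addrA lerDl.
  by rewrite addr_ge0// mulr_ge0 ?exprn_ge0 ?Li_coef_ge0.
by apply: le_trans (H n) _; rewrite gerBl.
Qed.

Lemma zetaE (R : realType) (k : nat) :
  zeta (k%:R : R) = limn (pseries (Li_coef R [::] k) 1).
Proof.
rewrite -limn_shiftS; congr (limn _); apply/funext => N.
rewrite big_add1/= /pseries /series/= big_nat_recl//= mul0r add0r.
apply: eq_bigr => i _.
by rewrite powRN powR_mulrn// expr1n mulr1 Li_partial_nil mul1r.
Qed.

(** Left continuity at 1 by squeezing: as the coefficients are nonnegative, the value at 1 - x lies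
    between its [N]-th partial sum and the full sum at 1. *)
Lemma polylog_cvg_zeta (R : realType) (k : nat) :
  Li [:: k.+2] (1 - x) @[x --> 0^'+] --> zeta (k.+2%:R : R).
Proof.
rewrite zetaE; set c := Li_coef R [::] k.+2.
have c1 : cvgn (pseries c 1) by exact: is_cvg_pseries_Li_coef_nil_1.
have c0 n : 0 <= c n by exact: Li_coef_ge0.
have nd y : 0 <= y -> nondecreasing_seq (pseries c y).
  move=> y0; apply/nondecreasing_seqP => n; rewrite pseriesS lerDl.
  by rewrite mulr_ge0 ?exprn_ge0.
apply/cvgrPdist_lt => e e0.
have /cvgrPdist_lt/(_ (e / 2)) := c1; rewrite divr_gt0// => /(_ isT)[N _ NL].
have {NL} := NL N (leqnn N) => /=.
rewrite ger0_norm ?subr_ge0 => [NL|]; last exact: nondecreasing_cvgn_le (nd _ _) _ _.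
near=> x.
have x0 : 0 < x by near: x; exact: nbhs_right_gt.
have x1 : x < 1 by near: x; apply: nbhs_right_lt.
have xN : x < e / 2 / N.+1%:R.
  by near: x; apply: nbhs_right_lt; rewrite !divr_gt0.
rewrite ltr_pdivlMr// in xN.
have cx : cvgn (pseries c (1 - x)) by apply: is_cvg_pseries_Li_coef; lra.
have le1 : Li [:: k.+2] (1 - x) <= limn (pseries c 1).
  rewrite (Li_rcons [::]); apply: ler_lim => //; apply: nearW => n.
  by apply: ler_sum => i _ /=; rewrite expr1n ler_wpM2l// exprn_ile1//; lra.
have le2 : pseries c (1 - x) N <= Li [:: k.+2] (1 - x).
  rewrite (Li_rcons [::]); apply: nondecreasing_cvgn_le => //.
  by apply: nd; lra.
(* By Bernoulli's inequality the term of index n loses at most n x c_n, which is at most x because n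
   c_n <= 1. *)
have le3 : pseries c 1 N - N%:R * x <= pseries c (1 - x) N.
  elim: (N) => [|n IH].
    by rewrite /pseries /series/= !big_geq// mul0r subr0.
  rewrite !pseriesS expr1n mulr1.
  have cn : c n * n%:R <= 1.
    case: n {IH} => [|n]; first by rewrite mulr0.
    rewrite /c Li_coef_nilE mulrC ler_pdivrMr ?exprn_gt0// mul1r exprS.
    by rewrite ler_peMr// exprn_ege1// ler1n.
  have := ler_wpM2l (c0 n) (bernoulli_le n (ltW x0) (ltW x1)).
  rewrite -natr1; nra.
rewrite ger0_norm ?subr_ge0//.
have : N%:R * x <= x * N.+1%:R by rewrite mulrC ler_pM2l// ler_nat.
lra.
Unshelve. all: by end_near. Qed.

(** * The duality formula *)

Lemma is_derive_Li_rcons (R : realType) (ks : seq nat) (k : nat) (x : R) :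
  0 < x -> x < 1 ->
  is_derive x 1 (@Li R (rcons ks k.+1)) (Li (rcons ks k) x / x).
Proof.
move=> x0 x1; have xn : `|x| < 1 by rewrite gtr0_norm.
have D := is_derive_Li ks k.+1 xn; apply: is_derive_eq.
by rewrite -(mul_lim_pseries_diffs_Li_coef ks k (ltW x0) x1) mulrC mulKf ?gt_eqF.
Qed.

Lemma is_derive_Li_rcons1 (R : realType) (ks : seq nat) (x : R) :
  0 < x -> x < 1 ->
  is_derive x 1 (@Li R (rcons ks 1%N)) (Li ks x / (1 - x)).
Proof.
move=> x0 x1; have D := is_derive_Li_rcons ks 0 x0 x1; apply: is_derive_eq.
rewrite Li_rcons0_exponent// ?ltW//.
have xn : x != 0 by rewrite gt_eqF.
have x1n : 1 - x != 0 by rewrite subr_eq0 gt_eqF.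
by field; rewrite xn x1n.
Qed.

Lemma rcons_nseq (T : Type) (n : nat) (a : T) : rcons (nseq n a) a = nseq n.+1 a.
Proof. by rewrite -cats1 -(nseqD n 1) addn1. Qed.

Lemma is_derive_Li_nseq1 (R : realType) (k : nat) (x : R) :
  0 < x -> x < 1 ->
  is_derive x 1 (@Li R (nseq k 1%N))
    (if k is k'.+1 then Li (nseq k' 1%N) x / (1 - x) else 0).
Proof.
move=> x0 x1; case: k => [|k].
  have -> : @Li R (nseq 0 1%N) = cst 1 by apply/funext => y; rewrite Li_nil.
  exact: is_derive_cst.
by rewrite -rcons_nseq; exact: is_derive_Li_rcons1.
Qed.

Lemma is_derive_polylog_onem (R : realType) (k : nat) (x : R) :
  0 < x -> x < 1 ->
  is_derive x 1 (fun y : R => Li [:: k.+1] (1 - y))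
    (- Li [:: k] (1 - x) / (1 - x)).
Proof.
move=> x0 x1.
have D : is_derive (1 - x) 1 (@Li R [:: k.+1]) (Li [:: k] (1 - x) / (1 - x)).
  by apply: (is_derive_Li_rcons [::]); lra.
have D1 : is_derive x 1 (fun y : R => 1 - y) (-1).
  by apply: is_derive_eq; rewrite add0r mul1r.
have := @is_derive1_comp R (@Li R [:: k.+1]) (fun y : R => 1 - y) x _ _ D D1.
by rewrite mulrN1 mulNr.
Qed.

Lemma is_derive_bigsum (R : realType) (n : nat) (f : 'I_n -> R -> R)
    (df : 'I_n -> R) (x : R) :
  (forall i, is_derive x 1 (f i) (df i)) ->
  is_derive x 1 (fun y => \sum_(i < n) f i y) (\sum_(i < n) df i).
Proof.
move=> D; have := is_derive_sum D.
by congr is_derive; apply/funext => y; rewrite fct_sumE.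
Qed.

(** The left side is (1 - x) times the derivative of the mixed sum, with a_k = Li_{1^k}(x) and b_l =
    Li_l(1 - x). Shifting [m] by one in the subtracted sum aligns the products, and Pascal's rule
    combines their coefficients. For d = 0 all coefficients are 1, so only the end term remains. *)
Lemma binomial_telescope (R : realType) (a b : nat -> R) (j d : nat) :
  \sum_(m < j.+1) 'C(d + m, d)%:R *
    ((if (j - m)%N is k.+1 then a k else 0) * b (d + m).+1 -
     a (j - m)%N * b (d + m)%N) =
  - (if d is d'.+1 then
       \sum_(m < j.+1) 'C(d' + m, d')%:R * a (j - m)%N * b (d' + m).+1
     else a j * b 0%N).
Proof.
under eq_bigr do rewrite mulrBr.
rewrite sumrB big_ord_recr/= subnn mul0r mulr0 addr0.
rewrite [X in _ - X]big_ord_recl/= addn0 binn mul1r subn0.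
have E (i : 'I_j) : (if (j - i)%N is k.+1 then a k else 0) = a (j - i.+1)%N.
  by rewrite subnS; case: (j - i)%N (subn_gt0 i j) => [|//]; rewrite ltn_ord.
under eq_bigr do rewrite E.
rewrite opprD addrCA -sumrB.
case: d => [|d].
  by rewrite big1 ?addr0// => i _; rewrite !bin0 /bump/= !add0n add1n subrr.
rewrite [in RHS]big_ord_recl/= addn0 binn mul1r subn0 opprD; congr (_ + _).
rewrite -sumrN; apply: eq_bigr => i _.
rewrite /bump/= add1n !addSn !addnS (binS (d + i).+1 d).
by rewrite natrD; ring.
Qed.

(** The first factor vanishes to first order at 0, which outweighs the possible logarithmic
    divergence of the second. *)
Lemma Li_nseq1_mul_polylog_cvg0 (R : realType) (k l : nat) :
  Li (nseq k.+1 1%N) x * Li [:: l.+1] (1 - x) @[x --> 0^'+] --> (0 : R).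
Proof.
have [c] := Li_rcons_div_cvg0 R (nseq k 1%N) 1 => hc.
have h : Li (rcons (nseq k 1%N) 1%N) x / x * (x * Li [:: l.+1] (1 - x))
    @[x --> 0^'+] --> (0 : R).
  by rewrite -[X in _ --> X](mulr0 c); apply: cvgM => //; exact: mul_polylog_cvg.
rewrite rcons_nseq in h; apply: cvg_trans h; apply: near_eq_cvg; near=> x.
have x0 : x != 0 by rewrite gt_eqF//; near: x; exact: nbhs_right_gt.
by rewrite /= mulrA divfK.
Unshelve. all: by end_near. Qed.

Lemma Li_nseq1_cvg0 (R : realType) (k : nat) :
  Li (nseq k 1%N) x @[x --> 0^'+] --> ((k == 0)%N%:R : R).
Proof.
case: k => [|k]; last by rewrite -rcons_nseq; exact: Li_rcons_cvg0.
by under eq_fun do rewrite Li_nil; exact: cvg_cst.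
Qed.

(** The first sum of the formula, with x = 1 - z and d = r - j. *)
Definition zeta_part (R : realType) (j d : nat) (x : R) : R :=
  \sum_(i < d.+1) (-1) ^+ i * 'C(i + j, i)%:R * zeta ((i + j + 1)%:R : R) *
    Li (nseq (d - i) 1%N) x.

(** The second sum without its sign, in the same variables and with l = d + m. *)
Definition mixed_part (R : realType) (j d : nat) (x : R) : R :=
  \sum_(m < j.+1) 'C(d + m, d)%:R * Li (nseq (j - m) 1%N) x *
    Li [:: (d + m).+1] (1 - x).

(** The summand i = d is constant. Each other one loses an index 1, which gives the sum for d -
    1. *)
Lemma is_derive_zeta_part (R : realType) (j d : nat) (x : R) :
  0 < x -> x < 1 ->
  is_derive x 1 (@zeta_part R j d)
    (if d is d'.+1 then zeta_part j d' x / (1 - x) else 0).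
Proof.
move=> x0 x1.
have D := @is_derive_bigsum R d.+1 _ _ x (fun i : 'I_d.+1 =>
  @is_deriveZ _ _ _ _ ((-1) ^+ i * 'C(i + j, i)%:R * zeta ((i + j + 1)%:R : R))
   _ _ _ (is_derive_Li_nseq1 (d - i) x0 x1)).
apply: is_derive_eq; case: d {D} => [|d]; first by rewrite big_ord1 scaler0.
rewrite big_ord_recr/= subnn scaler0 addr0 mulr_suml; apply: eq_bigr => i _.
by rewrite subSn ?leq_ord// /GRing.scale/= !mulrA.
Qed.

Lemma is_derive_mixed_part (R : realType) (j d : nat) (x : R) :
  0 < x -> x < 1 ->
  is_derive x 1 (@mixed_part R j d)
    (- (if d is d'.+1 then mixed_part j d' x
        else Li (nseq j 1%N) x * ((1 - x) / x)) / (1 - x)).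
Proof.
move=> x0 x1.
have D := @is_derive_bigsum R j.+1 _ _ x (fun m : 'I_j.+1 =>
  is_deriveM (@is_deriveZ _ _ _ _ ('C(d + m, d)%:R : R) _ _ _
    (is_derive_Li_nseq1 (j - m) x0 x1)) (is_derive_polylog_onem (d + m) x0 x1)).
apply: is_derive_eq.
(* Reading (1 - x) / x as Li_0(1 - x) makes the case d = 0 an instance of [binomial_telescope]. *)
have p0 : Li [:: 0%N] (1 - x) = (1 - x) / x.
  by rewrite (Li_rcons0_exponent [::]) ?Li_nil ?subKr ?mulr1//; lra.
rewrite -p0.
have := binomial_telescope (fun k => Li (nseq k 1%N) x)
  (fun l => Li [:: l] (1 - x)) j d => /= <-.
rewrite mulr_suml; apply: eq_bigr => m _.
case: (j - m)%N => [|k]; rewrite /GRing.scale/=; ring.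
Qed.

Lemma zeta_part_cvg0 (R : realType) (j d : nat) :
  zeta_part j d x @[x --> 0^'+] -->
  (-1) ^+ d * 'C(d + j, d)%:R * zeta ((d + j + 1)%:R : R).
Proof.
have H : zeta_part j d x @[x --> 0^'+] --> \sum_(i < d.+1)
    (-1) ^+ i * 'C(i + j, i)%:R * zeta ((i + j + 1)%:R : R) *
    ((d - i == 0)%N%:R : R).
  apply: (cvg_big add_continuous) => i _.
  by apply: cvgM; [exact: cvg_cst|exact: Li_nseq1_cvg0].
rewrite big_ord_recr/= subnn mulr1 big1 ?add0r in H => // i _.
by rewrite subn_eq0 leqNgt ltn_ord mulr0.
Qed.

Lemma mixed_part_cvg0 (R : realType) (j d : nat) : (0 < j)%N ->
  mixed_part j d x @[x --> 0^'+] -->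
  'C(d + j, d)%:R * zeta ((d + j + 1)%:R : R).
Proof.
move=> j0.
have H : mixed_part j d x @[x --> 0^'+] --> \sum_(m < j.+1)
    'C(d + m, d)%:R * ((j - m == 0)%N%:R * zeta ((d + j + 1)%:R : R)).
  apply: (cvg_big add_continuous) => m _.
  under eq_fun do rewrite -mulrA.
  apply: cvgM; first exact: cvg_cst.
  case jm : (j - m)%N => [|k].
    have -> : nat_of_ord m = j by have := ltn_ord m; lia.
    under eq_fun do rewrite Li_nil mul1r.
    (* Positivity of [j] makes the exponent d + j + 1 at least 2, so the zeta value is a convergent
       series. *)
    rewrite mul1r; case: (d + j)%N (leq_addl d j) => [|n _]; first by lia.
    by rewrite addn1; exact: polylog_cvg_zeta.
  by rewrite mul0r; exact: Li_nseq1_mul_polylog_cvg0.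
rewrite big_ord_recr/= subnn mul1r big1 ?add0r in H => // i _.
by rewrite subn_eq0 leqNgt ltn_ord mul0r mulr0.
Qed.

(** * The difference of the two sides *)

Lemma Li_nseq_cat_nseq_cvg0 (R : realType) (j d : nat) :
  Li (nseq j 1%N ++ 2%N :: nseq d 1%N) x @[x --> 0^'+] --> (0 : R).
Proof. by rewrite lastI -rcons_cat; exact: Li_rcons_cvg0. Qed.

Lemma is_derive_Li_nseq_cat_nseq (R : realType) (j d : nat) (x : R) :
  0 < x -> x < 1 ->
  is_derive x 1 (@Li R (nseq j 1%N ++ 2%N :: nseq d 1%N))
    (if d is d'.+1 then Li (nseq j 1%N ++ 2%N :: nseq d' 1%N) x / (1 - x)
     else Li (nseq j.+1 1%N) x / x).
Proof.
move=> x0 x1; case: d => [|d].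
  by rewrite cats1 -rcons_nseq; exact: is_derive_Li_rcons.
by rewrite -rcons_nseq -rcons_cons -rcons_cat; exact: is_derive_Li_rcons1.
Qed.

Lemma Li_duality_sub_cvg0 (R : realType) (j d : nat) :
  Li (nseq j 1%N ++ 2%N :: nseq d 1%N) x -
    (zeta_part j.+1 d x - (-1) ^+ d * mixed_part j.+1 d x)
    @[x --> 0^'+] --> (0 : R).
Proof.
set z := (-1) ^+ d * 'C(d + j.+1, d)%:R * zeta ((d + j.+1 + 1)%:R : R).
have zE : z = (-1) ^+ d * ('C(d + j.+1, d)%:R * zeta (d + j.+1 + 1)%:R).
  by rewrite mulrA.
(* The limit 0 is written as 0 - (z - z), [z] being the common limit of [zeta_part] and of the
   signed [mixed_part]. *)
rewrite -[X in _ --> X](subr0 0) -[X in _ --> _ - X](subrr z).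
apply: cvgB; first exact: Li_nseq_cat_nseq_cvg0.
apply: cvgB; first exact: zeta_part_cvg0.
by rewrite zE; apply: cvgM; [exact: cvg_cst|exact: mixed_part_cvg0].
Qed.

(** Here [j] is one less than in the theorem. The induction on [d] uses that the derivative of the
    difference for d + 1 is the difference for d divided by 1 - x. *)
Lemma Li_duality (R : realType) (j d : nat) (x : R) : 0 < x -> x < 1 ->
  Li (nseq j 1%N ++ 2%N :: nseq d 1%N) x =
  zeta_part j.+1 d x - (-1) ^+ d * mixed_part j.+1 d x.
Proof.
move=> x0 x1; apply/eqP; rewrite -subr_eq0; apply/eqP; move: x x0 x1.
elim: d => [|d IH]; apply: eq0_from_derive0 (@Li_duality_sub_cvg0 R j _) => x x0 x1.
  (* For d = 0 the left side and the mixed part both contribute Li_{1^(j+1)}(x) / x, with opposite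
     signs. *)
  have D := is_deriveB (is_derive_Li_nseq_cat_nseq j 0 x0 x1)
    (is_deriveB (is_derive_zeta_part j.+1 0 x0 x1)
      (is_deriveZ ((-1) ^+ 0) (is_derive_mixed_part j.+1 0 x0 x1))).
  apply: is_derive_eq; rewrite /GRing.scale/=.
  have xn : x != 0 by rewrite gt_eqF.
  have x1n : 1 - x != 0 by rewrite subr_eq0 gt_eqF.
  by field; rewrite xn x1n.
have D := is_deriveB (is_derive_Li_nseq_cat_nseq j d.+1 x0 x1)
  (is_deriveB (is_derive_zeta_part j.+1 d.+1 x0 x1)
    (is_deriveZ ((-1) ^+ d.+1) (is_derive_mixed_part j.+1 d.+1 x0 x1))).
apply: is_derive_eq; rewrite /GRing.scale/=.
by rewrite -[RHS](mul0r (1 - x)^-1) -(IH _ x0 x1) exprS; ring.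
Qed.

Theorem theorem2p9 (R : realType) (r j : nat) (z : R)
    (j_gt0 : (0 < j)%N) (le_jr : (j <= r)%N) (z_gt0 : 0 < z) (z_lt1 : z < 1) :
  Li (nseq (j - 1) 1%N ++ 2%N :: nseq (r - j) 1%N) (1 - z) =
    \sum_(0 <= i < (r - j).+1)
       (-1) ^+ i * 'C(i + j, i)%:R * zeta ((i + j + 1)%:R : R) *
       Li (nseq (r - j - i) 1%N) (1 - z)
    + (-1) ^ (r%:Z - j%:Z - 1) *
      \sum_(r - j <= l < r.+1)
         'C(l, r - j)%:R * Li (nseq (r - l) 1%N) (1 - z) * Li [:: l.+1] z.
Proof.
(* The exponent is an integer and equals -1 when r = j. *)
have signE : (-1) ^ (r%:Z - j%:Z - 1) = - (-1) ^+ (r - j) :> R.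
  by rewrite subzn// expfzDr ?oppr_eq0 ?oner_neq0// exprN1 invrN1 mulrN1.
(* In this form, the substitution l = m + (r - j) leaves a sum over m < j + 1. *)
have rE : r.+1 = (j.+1 + (r - j))%N by lia.
rewrite signE subn1 Li_duality ?subr_gt0 ?gtrBl// prednK// mulNr.
congr (_ - _ * _); first by rewrite big_mkord.
rewrite rE -[X in index_iota X _]add0n big_addn addnK big_mkord.
apply: eq_bigr => m _; rewrite subKr addnC; congr (_ * Li (nseq _ _) _ * _).
by have := ltn_ord m; lia.
Qed.
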